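(* The program $$v^*=\min_{x\in\mathcal X,\,t,\,z(\cdot),\,s(\cdot)}\{t:\ g(x,\tilde\xi)\le s(\tilde\xi),\ \mathbb E[z(\tilde\xi)]\ge1-\varepsilon,\ \mathbb E[z(\tilde\xi)s(\tilde\xi)]=0,\ z(\tilde\xi)\in[0,1],\ s(\tilde\xi)\ge0,\ c^\top x\le t\}$$ (a reformulation of the chance constrained program $\min_{x\in\mathcal X}\{c^\top x:\mathbb P\{g(x,\tilde\xi)\le0\}\ge1-\varepsilon\}$) is equivalent to the bilevel program $$v^*=\min_t\ t$$ subject to $$(x^*,s^*(\cdot),z^*(\cdot))\in\operatorname*{argmin}_{x\in\mathcal X,\ z(\cdot)\in[0,1],\ s(\cdot)\ge0}\{\mathbb E[z(\tilde\xi)s(\tilde\xi)]:\ g(x,\tilde\xi)\le s(\tilde\xi),\ \mathbb E[z(\tilde\xi)]\ge1-\varepsilon,\ c^\top x\le t\},$$ $$\mathbb P\{g(x^*,\tilde\xi)\le0\}\ge1-\varepsilon.$$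
   Context: Setting. $\tilde\xi$ is a random vector on a probability space $(\Omega,\mathcal F,\mathbb P)$ with support $\Xi\subseteq\mathbb R^m$; $\varepsilon\in(0,1)$; $c\in\mathbb R^n$. $z(\cdot),s(\cdot):\Xi\to\mathbb R$ are measurable functions; all constraints on random quantities hold almost surely. Standing assumptions. (A1) $g(x,\xi)=\max_{i\in[I]}g_i(x,\xi)$ with $g_i:\mathbb R^n\times\Xi\to\mathbb R$, each $g_i(x,\xi)$ convex and lower semicontinuous in $x$ for almost every $\xi\in\Xi$. (A2) $\mathcal X\subseteq\mathbb R^n$ is nonempty, closed, convex and contained in a closed pointed convex cone $\mathcal C$. (A3) The feasible region of the chance constrained program is nonempty and $c\in\mathrm{int}(\mathcal C^* )\cup\{0\}$ ($\mathcal C^*$ the dual cone). ''Equivalent'' means the two problems have the same optimal value. *)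

(* Defs.v *)
From HB Require Import structures.
From mathcomp Require Import all_boot all_order all_algebra.
From mathcomp Require Import all_classical all_reals all_analysis.

Set Implicit Arguments.
Unset Strict Implicit.
Unset Printing Implicit Defensive.

Import Order.TTheory GRing.Theory Num.Theory.
Import numFieldNormedType.Exports.

Local Open Scope classical_set_scope.
Local Open Scope ring_scope.

(* The Borel sigma-algebra on matrices, hence on R^m = 'rV[R]_m. *)
HB.instance Definition _ (R : realType) (m n : nat) :=
  @isMeasurable.Build (sigma_display (@open 'M[R]_(m, n))) 'M[R]_(m, n)
    <<s (@open 'M[R]_(m, n)) >> (@sigma_algebra0 _ _ _) (@sigma_algebraC _ _)
    (@sigma_algebra_bigcup _ _ _).

Section convex_geometry.
Context {R : realType} {n : nat}.

Definition dotp (u v : 'rV[R]_n) : R := \sum_(i < n) u ord0 i * v ord0 i.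

Definition convex_cone (C : set 'rV[R]_n) : Prop :=
  convex_set C /\ (forall (a : R) x, 0 <= a -> C x -> C (a *: x)).

Definition pointed (C : set 'rV[R]_n) : Prop :=
  forall x, C x -> C (- x) -> x = 0.

Definition dual_cone (C : set 'rV[R]_n) : set 'rV[R]_n :=
  [set y | forall x, C x -> 0 <= dotp y x].

End convex_geometry.

(* The support of the law of xi: the smallest closed set of probability one. *)
Definition is_support {d} {Omega : measurableType d} {R : realType}
    (P : probability Omega R) {m : nat} (xi : {RV P >-> 'rV[R]_m})
    (Xi : set 'rV[R]_m) : Prop :=
  [/\ closed Xi, P (xi @^-1` Xi) = 1%E &
      forall F : set 'rV[R]_m, closed F -> P (xi @^-1` F) = 1%E -> Xi `<=` F].

(* An optimal value that is attained, as meant by "min". *)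
Definition is_minimum {R : realType} (A : set R) (v : R) : Prop :=
  A v /\ lbound A v.

Section programs.
Context {d} {Omega : measurableType d} {R : realType}.
Context (P : probability Omega R) {m n I : nat}.
Context (xi : {RV P >-> 'rV[R]_m}) (Xi : set 'rV[R]_m).
Context (g : 'I_I.+1 -> 'rV[R]_n -> 'rV[R]_m -> R).
Context (X : set 'rV[R]_n) (c : 'rV[R]_n) (eps : R).

(* Functions on Xi are represented by total functions on R^m whose values
   outside Xi are irrelevant: measurability is required on Xi only, and
   expectations (f \_ Xi vanishes outside Xi) and probabilities see only the
   event that xi lies in Xi, which has probability one. *)

Definition gmax (x : 'rV[R]_n) (y : 'rV[R]_m) : R :=
  \big[Num.max/g ord0 x y]_(i < I.+1) g i x y.

Definition mean (f : 'rV[R]_m -> R) : \bar R := ('E_P[(f \_ Xi) \o xi])%E.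

Definition chance (x : 'rV[R]_n) : Prop :=
  ((1 - eps)%:E <= P (xi @^-1` (Xi `&` [set y | (gmax x y <= 0)%R])))%E.

(* "Almost surely" is with respect to P, i.e. for the composites with xi.
   These are the constraints shared by the single-level program and by the lower level
   of the bilevel program. *)
Definition feasible (t : R) (x : 'rV[R]_n) (z s : 'rV[R]_m -> R) : Prop :=
  [/\ X x, dotp c x <= t,
      measurable_fun Xi z /\ measurable_fun Xi s,
      [/\ {ae P, forall w, 0 <= z (xi w) <= 1},
          {ae P, forall w, 0 <= s (xi w)} &
          {ae P, forall w, gmax x (xi w) <= s (xi w)}] &
      ((1 - eps)%:E <= mean z)%E].

(* The objective of both programs is t, so their optimal values are the minima
   of the following sets of feasible t. *)
Definition single_level_values : set R :=
  [set t | exists x z s, feasible t x z s /\ mean (z \* s) = 0%E].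

Definition lower_level_argmin (t : R) (x : 'rV[R]_n) (z s : 'rV[R]_m -> R) :
    Prop :=
  feasible t x z s /\
  forall x' z' s', feasible t x' z' s' ->
    (mean (z \* s)%R <= mean (z' \* s')%R)%E.

Definition bilevel_values : set R :=
  [set t | exists x z s, lower_level_argmin t x z s /\ chance x].

End programs.

(* Main.v *)
Require Import Defs.
From HB Require Import structures.
From mathcomp Require Import all_boot all_order all_algebra.
From mathcomp Require Import all_classical all_reals all_analysis.
From mathcomp Require Import measurable_realfun.

Set Implicit Arguments.
Unset Strict Implicit.
Unset Printing Implicit Defensive.

Import Order.TTheory GRing.Theory Num.Theory.
Import numFieldNormedType.Exports.

Local Open Scope classical_set_scope.
Local Open Scope ring_scope.

(* A feasible point of either program yields some x in X satisfying the chance constraint with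
   c x <= t: when E[z s] = 0, z is bounded by the indicator of s = 0, hence of g(x, xi) <= 0.
   Conversely such an x is completed by z = 1_{g <= 0} and s = max(g, 0), which reaches the
   smallest possible lower-level objective, 0.  So both programs have exactly the feasible
   values t of the chance constrained program.  That program attains its minimum: its feasible
   set is closed (lower semicontinuity of g and continuity from above of P), and if c is in
   the interior of the dual cone, c x >= r |x| on the cone for some r > 0, so sublevel sets are
   compact; if c = 0 every feasible point is optimal. *)

(** * Linear functionals and coercivity on row vectors *)

Section rV_facts.
Context {R : realType} {n : nat}.
Implicit Types (c x : 'rV[R]_n) (C : set 'rV[R]_n).

Lemma dotp_continuous c : continuous (dotp c).
Proof.
apply: (@continuous_big _ _ _ 0 _ _ _ _ (fun i x => c ord0 i * x ord0 i)).
  exact: add_continuous.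
move=> i _ x; exact: (cvgM (cvg_cst _) (@coord_continuous R 1 n ord0 i x)).
Qed.

Lemma dotp0l x : dotp 0 x = 0.
Proof. by rewrite /dotp big1// => i _; rewrite mxE mul0r. Qed.

(** Shifting [c] by [e / 2] against the sign of a coordinate where [x] attains its maximum norm
    stays in the dual cone and lowers the pairing with [x] by exactly [e / 2] times that norm. *)
Lemma interior_dual_cone_coercive C c : interior (dual_cone C) c ->
  exists2 r : R, 0 < r & forall x, C x -> r * `|x| <= dotp c x.
Proof.
move=> /nbhs_ballP[e /= e0 ceC]; exists (e / 2); first by rewrite divr_gt0.
move=> x Cx; have [x0|x0] := eqVneq `|x| 0.
  rewrite x0 mulr0; apply: (ceC c) => //; exact: ballxx.
have [[k i] xi] : exists ij, `|x| = `|x ij.1 ij.2| := mx_norm_neq0 x0.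
rewrite {}xi /= (ord1 k) {k} in x0 *.
pose y := c - (e / 2 * Num.sg (x ord0 i)) *: delta_mx ord0 i.
suff : 0 <= dotp y x.
  have -> : dotp y x = dotp c x - e / 2 * `|x ord0 i|.
    rewrite /dotp (bigD1 i)//= [in RHS](bigD1 i)//= !mxE !eqxx mulr1 mulrBl.
    rewrite -(mulrA (e / 2)) -normrEsg addrAC; congr (_ + _ - _).
    by apply: eq_bigr => j /negPf ji; rewrite !mxE ji andbF mulr0 subr0.
  by rewrite subr_ge0.
apply: (ceC y) => //; split=> // k j; rewrite /ball/= /y !mxE opprB addrC subrK.
have e2 : e / 2 < e by rewrite ltr_pdivrMr// ltr_pMr// ltr1n.
rewrite normrM normrM (gtr0_norm (divr_gt0 e0 _))// normr_sg.
apply: le_lt_trans e2; rewrite -mulrA ler_piMr ?(ltW (divr_gt0 e0 _))//.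
by rewrite normr_nat -natrM lern1 (leq_mul (leq_b1 _) (leq_b1 _)).
Qed.

(** Coercivity confines the sublevel set [L] of [x0] to radius [dotp c x0 / r], so [L] is compact;
    points of [K] outside [L] have larger values. *)
Lemma coercive_min (K : set 'rV[R]_n) c (r : R) : 0 < r ->
  closed K -> K !=set0 -> (forall x, K x -> r * `|x| <= dotp c x) ->
  exists2 x, K x & forall y, K y -> dotp c x <= dotp c y.
Proof.
move=> r0 Kcl [x0 Kx0] coer.
pose L := K `&` dotp c @^-1` [set t | t <= dotp c x0].
have Lcl : closed L.
  apply: closedI => //; apply: preimage_closed; last exact: closed_le.
  by move=> x _; exact: dotp_continuous.
have Lbd : bounded_set L.
  exists (dotp c x0 / r); split=> [|M ltM x [Kx cx]]; first exact: num_real.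
  apply: le_trans (ltW ltM); rewrite ler_pdivlMr// mulrC.
  exact: le_trans (coer _ Kx) cx.
have Lc := bounded_closed_compact Lbd Lcl.
have [||x] := EVT_min_rV (f := dotp c) _ Lc.
- by exists x0; split=> //=.
- apply: continuous_subspaceT; exact: dotp_continuous.
rewrite inE => -[Kx _] xmin; exists x => // y Ky.
have [yx0|/ltW x0y] := leP (dotp c y) (dotp c x0).
  by apply: xmin; rewrite inE.
by apply: le_trans x0y; apply: xmin; rewrite inE; split=> //=.
Qed.

End rV_facts.

Lemma closed_measurable_mx {R : realType} {m n : nat} (A : set 'M[R]_(m, n)) :
  closed A -> measurable A.
Proof.
move=> Acl; rewrite -(setCK A); apply: measurableC.
by apply: sub_sigma_algebra; exact: closed_openC.
Qed.

(** * Expectations and probabilities under almost sure hypotheses *)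

Section ae_expectation.
Context {d} {T : measurableType d} {R : realType} (P : probability T R).
Implicit Types (X : T -> R) (A B : set T).

(** Passing to the absolute value makes the integrand nonnegative everywhere, not only almost
    surely. *)
Lemma expectation_ae_norm X : measurable_fun setT X ->
  {ae P, forall w, 0 <= X w} -> ('E_P[X] = \int[P]_w `|(X w)%:E|)%E.
Proof.
move=> mX X0; rewrite unlock; apply: ae_eq_integral => //.
- exact/measurable_EFinP.
- by apply: measurableT_comp => //; exact/measurable_EFinP.
- by apply: filterS X0 => w Xw _; rewrite gee0_abs// lee_fin.
Qed.

Lemma ae_expectation_ge0 X : measurable_fun setT X ->
  {ae P, forall w, 0 <= X w} -> (0 <= 'E_P[X])%E.
Proof. by move=> mX X0; rewrite expectation_ae_norm// integral_ge0. Qed.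

Lemma ae_expectation_eq0 X : measurable_fun setT X ->
  {ae P, forall w, 0 <= X w} -> ('E_P[X] = 0)%E -> {ae P, forall w, X w = 0}.
Proof.
move=> mX X0; rewrite expectation_ae_norm//.
move/(ae_eq_integral_abs P measurableT (f := EFin \o X)).
have mEX : measurable_fun setT (EFin \o X) by exact/measurable_EFinP.
by move=> /(_ mEX); apply: filterS => w /(_ I) [].
Qed.

Lemma ae_expectation_le_measure X A : measurable_fun setT X -> measurable A ->
  {ae P, forall w, 0 <= X w} -> {ae P, forall w, X w <= \1_A w} ->
  ('E_P[X] <= P A)%E.
Proof.
move=> mX mA X0 XA; rewrite expectation_ae_norm// -(expectation_indic P mA).
rewrite unlock; apply: ae_ge0_le_integral => //.
- by apply: measurableT_comp => //; exact/measurable_EFinP.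
- by apply/measurable_EFinP; exact/measurable_indicP.
- by apply: filterS2 X0 XA => w X0 XA _; rewrite gee0_abs ?lee_fin.
Qed.

Lemma ae_le_measure A B : measurable A -> measurable B ->
  {ae P, forall w, A w -> B w} -> (P A <= P B)%E.
Proof.
move=> mA mB AB; rewrite -(expectation_indic P mA).
apply: ae_expectation_le_measure => //.
- by apply: aeW => w.
- apply: filterS AB => w AB; rewrite !indicE.
  have [/set_mem/AB/mem_set->//|_] := boolP (w \in A).
  by rewrite ler_nat.
Qed.

(** The preimage under [X] of a null set for the law is null for [P]. This carries lower
    semicontinuity of [g] over to the sample space. *)
Lemma ae_distribution d' (U : measurableType d') (X : {RV P >-> U})
    (Q : U -> Prop) :
  {ae distribution P X, forall y, Q y} -> {ae P, forall w, Q (X w)}.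
Proof.
move=> [N [mN N0 QN]]; exists (X @^-1` N); split=> //.
- by rewrite -[_ @^-1` _]setTI; exact: measurable_funPT.
- by move=> w /= /QN.
Qed.

(** The tail unions decrease to the lim sup and each contains some [F k]; continuity from above
    passes the bound to the limit. *)
Lemma lim_sup_set_ge (F : (set T)^nat) (a : \bar R) :
  (forall k, measurable (F k)) -> (forall k, (a <= P (F k))%E) ->
  (a <= P (lim_sup_set F))%E.
Proof.
move=> mF aF.
have := lim_sup_set_cvg P F mF.
rewrite (le_lt_trans (probability_le1 P _)) ?ltry//; last first.
  by apply: bigcup_measurable => k _.
move=> /(_ isT); apply: cvge_ge; apply: nearW => k.
apply: le_trans (aF k) _; rewrite le_measure ?inE//.
- by apply: bigcup_measurable => j _.
- by apply: bigcup_sup => /=.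
Qed.

End ae_expectation.

(** * Reduction of both programs to the chance constrained program *)

Section chance_constrained_program.
Context {d} {Omega : measurableType d} {R : realType}.
Context (P : probability Omega R) {m n I : nat}.
Context (xi : {RV P >-> 'rV[R]_m}) (Xi : set 'rV[R]_m).
Context (g : 'I_I.+1 -> 'rV[R]_n -> 'rV[R]_m -> R).
Context (X : set 'rV[R]_n) (c : 'rV[R]_n) (eps : R).
Context (hXi : is_support xi Xi).
Context (g_meas : forall i x, measurable_fun Xi (g i x)).

(** Epigraph form of the chance constrained program, the common description of both sets of
    values. *)
Definition chance_values : set R :=
  [set t | exists2 x, X x /\ chance xi Xi g eps x & dotp c x <= t].

Definition safe_event (x : 'rV[R]_n) : set Omega :=
  xi @^-1` (Xi `&` [set y | gmax g x y <= 0]).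

(** The default value [g ord0 x y] of the big maximum belongs to the family, so it adds no
    constraint. *)
Lemma gmax_le0P x y : gmax g x y <= 0 <-> forall i, g i x y <= 0.
Proof.
split=> [gx0 i|gx0]; first exact: le_trans (le_bigmax _ _ i) gx0.
by apply/bigmax_leP; split=> [|i _]; exact: gx0.
Qed.

Lemma measurable_support : measurable Xi.
Proof. by case: hXi => Xicl _ _; exact: closed_measurable_mx. Qed.

Lemma ae_support : {ae P, forall w, Xi (xi w)}.
Proof.
have mXi : measurable (xi @^-1` Xi).
  exact: measurable_funPTI measurable_support.
exists (~` (xi @^-1` Xi)); split=> //; first exact: measurableC.
case: hXi => _ PXi _.
by rewrite probability_setC// PXi subee.
Qed.

Lemma measurable_gmax x : measurable_fun Xi (gmax g x).
Proof.
rewrite /gmax; elim: (index_enum _) => [|i s IHs].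
  by under eq_fun do rewrite big_nil; exact: g_meas.
by under eq_fun do rewrite big_cons; exact: measurable_maxr.
Qed.

Lemma measurable_safe_support x :
  measurable (Xi `&` [set y | gmax g x y <= 0]).
Proof.
apply: measurable_fun_le => //; first exact: measurable_support.
exact: measurable_gmax.
Qed.

Lemma measurable_safe_event x : measurable (safe_event x).
Proof. exact: measurable_funPTI (measurable_safe_support x). Qed.

Lemma measurable_on_support (f : 'rV[R]_m -> R) : measurable_fun Xi f ->
  measurable_fun setT ((f \_ Xi) \o xi).
Proof.
move=> mf; apply: measurableT_comp; last exact: measurable_funP.
exact: (measurable_restrictT f measurable_support).1.
Qed.

(** [Q] depends on [w] so that a bound by the indicator of an event in [Omega] is covered. *)
Lemma ae_restrict_support (f : 'rV[R]_m -> R) (Q : Omega -> R -> Prop) :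
  {ae P, forall w, Q w (f (xi w))} ->
  {ae P, forall w, Q w (((f \_ Xi) \o xi) w)}.
Proof.
apply: filterS2 ae_support => w Xiw.
by rewrite /= patchE mem_set.
Qed.

Lemma feasible_product_ge0 t x z s : feasible xi Xi g X c eps t x z s ->
  measurable_fun setT (((z \* s) \_ Xi) \o xi) /\
  {ae P, forall w, 0 <= (((z \* s) \_ Xi) \o xi) w}.
Proof.
move=> [_ _ [mz ms] [z01 s0 _] _]; split.
  by apply: measurable_on_support; exact: measurable_funM.
apply: (ae_restrict_support (Q := fun _ r => 0 <= r)).
by apply: filterS2 z01 s0 => w /andP[z0 _] s0; exact: mulr_ge0.
Qed.

Lemma mean_ge0 t x z s : feasible xi Xi g X c eps t x z s ->
  (0 <= mean xi Xi (z \* s)%R)%E.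
Proof. by move=> /feasible_product_ge0[mzs zs0]; exact: ae_expectation_ge0. Qed.

(* [z s = 0] and [z <= 1] force [z] below the indicator of [s = 0], hence below that of
   [g <= 0]. *)
Lemma complementary_chance t x z s : feasible xi Xi g X c eps t x z s ->
  mean xi Xi (z \* s) = 0%E -> chance xi Xi g eps x.
Proof.
move=> fe; have [mzs zs_ge0] := feasible_product_ge0 fe.
case: fe => _ _ [mz ms] [z01 s0 gs] zE zs0.
have zs_eq0 := ae_expectation_eq0 mzs zs_ge0 zs0.
apply: le_trans zE _; rewrite -/(safe_event x).
apply: ae_expectation_le_measure.
- exact: measurable_on_support.
- exact: measurable_safe_event.
- apply: (ae_restrict_support (Q := fun _ r => 0 <= r)).
  by apply: filterS z01 => w /andP[].
- apply: (ae_restrict_support (Q := fun w r => r <= \1_(safe_event x) w)).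
  apply: filterS2 ae_support (filterI z01 (filterI s0 (filterI gs zs_eq0))).
  move=> w Xiw [/andP[z0 z1] [s0w [gsw]]].
  rewrite /= patchE mem_set//= indicE => /eqP; rewrite mulf_eq0 => zs.
  have [//|] := boolP (w \in _).
  case/orP: zs => /eqP zs; first by rewrite zs.
  by move=> /negP[]; rewrite inE; split => //=; rewrite -zs.
Qed.

Lemma chance_complementary t x : X x -> chance xi Xi g eps x -> dotp c x <= t ->
  exists z s, feasible xi Xi g X c eps t x z s /\ mean xi Xi (z \* s) = 0%E.
Proof.
move=> Xx chx cxt; set A := Xi `&` [set y | gmax g x y <= 0].
exists \1_A, (fun y => Num.max (gmax g x y) 0); split; last first.
  (* The product vanishes pointwise: the maximum is 0 on [A], the indicator is 0 off [A]. *)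
  rewrite /mean -[RHS](expectation_cst P 0); congr expectation.
  apply/funext => w /=; rewrite patchE; case: ifPn => // Xiw.
  rewrite /= indicE; have [|] := boolP (_ \in A); last by rewrite mul0r.
  by rewrite inE => -[_ /= g0]; rewrite max_r// mulr0.
split=> //.
- split; last by apply: measurable_maxr => //; exact: measurable_gmax.
  apply: measurable_funTS; apply/measurable_indicP.
  exact: measurable_safe_support.
- split; apply: aeW => w.
  + by rewrite indicE; case: (_ \in _); rewrite ?lexx ler01.
  + by rewrite le_max lexx orbT.
  + by rewrite le_max lexx.
- apply: le_trans chx _; rewrite -(expectation_indic P (measurable_safe_event x)).
  (* Equality holds: since [A] lies in [Xi], restricting [\1_A] to [Xi] changes nothing. *)
  rewrite le_eqVlt; apply/orP; left; apply/eqP; congr expectation.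
  apply/funext => w /=; rewrite patchE !indicE.
  case: ifPn => // /negP Xiw; case: (boolP (_ \in _)) => //.
  by rewrite inE => -[/mem_set].
Qed.

Lemma single_level_chance : single_level_values xi Xi g X c eps = chance_values.
Proof.
apply/seteqP; split=> [t [x [z [s [fe zs0]]]]|t [x [Xx chx] cxt]].
  by exists x; [split; [case: fe|exact: complementary_chance fe zs0]|case: fe].
exists x; exact: chance_complementary.
Qed.

Lemma bilevel_chance : bilevel_values xi Xi g X c eps = chance_values.
Proof.
apply/seteqP; split=> [t [x [z [s [[fe _] chx]]]]|t [x [Xx chx] cxt]].
  by exists x; [split=> //; case: fe|case: fe].
have [z [s [fe zs0]]] := chance_complementary Xx chx cxt.
exists x, z, s; split=> //; split=> // x' z' s' fe'.
by rewrite zs0; exact: mean_ge0 fe'.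
Qed.

(* If [x] is a limit of [u k], lower semicontinuity puts the limsup of the safe events of
   [u k] almost surely inside the safe event of [x]. *)
Lemma chance_closed :
  (forall i, {ae distribution P xi, forall y,
     lower_semicontinuous (fun x => (g i x y)%:E)}) ->
  closed [set x | chance xi Xi g eps x].
Proof.
move=> g_lsc x clx.
have /choice[u uP] : forall k : nat, exists v,
    chance xi Xi g eps v /\ ball x (k.+1%:R^-1) v.
  move=> k; have [|v [chv xv]] := clx (ball x k.+1%:R^-1); last by exists v.
  exact: nbhsx_ballx.
pose F k := safe_event (u k).
have mF k : measurable (F k) by exact: measurable_safe_event.
apply: (@le_trans _ _ (P (lim_sup_set F))).
  by apply: lim_sup_set_ge => // k; have [] := uP k.
rewrite -/(safe_event x); apply: ae_le_measure.
- apply: bigcap_measurable => // k _; exact: bigcup_measurable.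
- exact: measurable_safe_event.
- have lsc : {ae P, forall w, forall i,
      lower_semicontinuous (fun x => (g i x (xi w))%:E)}.
    by apply: filter_forall => i; exact: ae_distribution (g_lsc i).
  apply: filterS2 ae_support lsc => w Xiw lsc Fw; split=> //=.
  (* If [g i x (xi w)] were positive, it would stay positive on a ball around [x]. Since [w] lies in
     [F k] for arbitrarily large [k], some such [u k] falls in that ball, a contradiction. *)
  apply/gmax_le0P => i; rewrite leNgt; apply/negP => g0.
  have [V /nbhs_ballP[e /= e0 xeV] Vg] := lsc i x 0 g0.
  have [N _ eN] := near_infty_natSinv_lt (PosNum e0).
  have [k /= Nk [_ guk]] := Fw N Logic.I.
  have /Vg : V (u k).
    apply: xeV; apply: le_ball (uP k).2; apply: ltW; exact: eN.
  by rewrite lte_fin ltNge (gmax_le0P _ _).1.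
Qed.

End chance_constrained_program.

Theorem proposition2 (d : measure_display) (Omega : measurableType d)
    (R : realType) (P : probability Omega R) (m n I : nat)
    (xi : {RV P >-> 'rV[R]_m}) (Xi : set 'rV[R]_m)
    (g : 'I_I.+1 -> 'rV[R]_n -> 'rV[R]_m -> R)
    (X C : set 'rV[R]_n) (c : 'rV[R]_n) (eps : R)
    (hXi : is_support xi Xi)
    (heps : 0 < eps < 1)
    (g_meas : forall i x, measurable_fun Xi (g i x))
    (g_convex : forall i, {ae distribution P xi, forall y,
       convex_function setT (fun x => g i x y)})
    (g_lsc : forall i, {ae distribution P xi, forall y,
       lower_semicontinuous (fun x => (g i x y)%:E)})
    (X_nonempty : X !=set0) (X_closed : closed X) (X_convex : convex_set X)
    (C_closed : closed C) (C_cone : convex_cone C) (C_pointed : pointed C)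
    (XC : X `<=` C)
    (ccp_nonempty : exists2 x, X x & chance xi Xi g eps x)
    (hc : (interior (dual_cone C) `|` [set 0]) c) :
  exists v : R,
    is_minimum (single_level_values xi Xi g X c eps) v /\
    is_minimum (bilevel_values xi Xi g X c eps) v.
Proof.
rewrite single_level_chance// bilevel_chance//.
(* The least [t] in the epigraph form is the least cost, so it suffices to minimize [dotp c] over
   the chance constrained set. *)
suff [x [Xx chx] xmin] : exists2 x, X x /\ chance xi Xi g eps x &
    forall y, X y /\ chance xi Xi g eps y -> dotp c x <= dotp c y.
  exists (dotp c x).
  suff : is_minimum (chance_values xi Xi g X c eps) (dotp c x) by [].
  split; first by exists x.
  by move=> t [y Ky] /(le_trans (xmin y Ky)).
have [x0 Xx0 chx0] := ccp_nonempty.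
case: hc => [/interior_dual_cone_coercive[r r0 coer]|/= ->]; last first.
  by exists x0 => // y _; rewrite !dotp0l.
apply: (coercive_min (K := X `&` [set x | chance xi Xi g eps x]) r0).
- by apply: closedI => //; exact: chance_closed.
- by exists x0.
- by move=> x [/XC Cx _]; exact: coer.
Qed.
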